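(* Let $m\ge 2$ be an integer and let $p$ be a prime with $p\mid m$. If there exists $k\in\mathbb{N}$ such that $g_m(k)\neq g_p(k)$, then $g_m:\mathbb{N}\to\mathbb{N}$ is not injective.
   Context: $\mathbb{N}=\{0,1,2,\dots\}$. For an integer $m\ge 2$, an $m$-product sequence is a finite sequence of integers $a_1\le a_2\le\dots\le a_t$ such that $\prod_{i=1}^t a_i=R^m$ for some $R\in\mathbb{N}$ and no integer appears more than $m-1$ times in the sequence. For $n\in\mathbb{N}$, $g_m(n)$ is the least integer $s$ such that there exists an $m$-product sequence $a_1\le\dots\le a_t$ with $a_1=n$ and $a_t=s$. *)

(* Defs.v *)
From mathcomp Require Import all_boot all_order all_algebra.
From mathcomp Require Import boolp classical_sets.

Set Implicit Arguments.
Unset Strict Implicit.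
Unset Printing Implicit Defensive.

Import Order.TTheory GRing.Theory Num.Theory.
Local Open Scope ring_scope.

Definition product_sequence (m : nat) (a : seq int) : Prop :=
  [/\ sorted <=%R a,
      exists R : nat, \prod_(x <- a) x = R%:Z ^+ m
    & forall x : int, (count_mem x a <= m - 1)%N].

(* The sequence is required to be nonempty, so the default value of [head] and
   [last] is never used. *)
Definition product_sequence_from_to (m : nat) (x y : int) : Prop :=
  exists a : seq int,
    [/\ product_sequence m a, a <> [::], head 0 a = x & last 0 a = y].

Definition least_product_end (m n : nat) (s : int) : Prop :=
  product_sequence_from_to m n%:Z s /\
  (forall s' : int, product_sequence_from_to m n%:Z s' -> s <= s').

(* The least end [s] ranges over all integers; it is a natural number because
   [n <= s].  For [2 <= m] it exists (lemma [gP]), so the default 0 is only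
   taken outside the intended range of [m]. *)
Definition g (m n : nat) : nat :=
  xget 0%N [set s : nat | least_product_end m n s%:Z]%classic.

Lemma product_sequence_from_to_le (m : nat) (x y : int) :
  product_sequence_from_to m x y -> x <= y.
Proof.
case=> -[|b a] [[sa _ _] _ <- <-] //=.
have := mem_last b a; rewrite in_cons => /orP[/eqP-> //|].
by move: sa; rewrite /= (path_sortedE le_trans) => /andP[/allP h _] /h.
Qed.

Lemma product_sequence_from_to_exists (m n : nat) :
  (1 < m)%N -> exists s : nat, product_sequence_from_to m n%:Z s%:Z.
Proof.
case: m => [|[|m]] // _; case: n => [|n].
  exists 0%N, [:: 0]; split=> //; split=> //.
    by exists 0%N; rewrite big_seq1 expr0n.
  by move=> x /=; case: eqP.
pose s := (n.+1 ^ m.+1 * 2 ^ m.+2)%N.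
have lt_ns : (n.+1 < s)%N.
  rewrite (@leq_ltn_trans (n.+1 ^ m.+1)) //.
    by rewrite expnS leq_pmulr // expn_gt0.
  by rewrite ltn_Pmulr ?expn_gt0 // -{1}(expn0 2) ltn_exp2l.
exists s, [:: n.+1%:Z; s%:Z]; split=> //; split.
- by rewrite /= andbT lez_nat ltnW.
- exists (n.+1 * 2)%N; rewrite big_cons big_seq1 -PoszM.
  rewrite -(natz (n.+1 * 2)) -natrX natz; congr Posz.
  by rewrite /s mulnA -expnS -expnMn.
- move=> x /=; rewrite addn0.
  have [<-|_] := eqVneq n.+1%:Z x; last by case: eqP.
  by rewrite eqz_nat gtn_eqF.
Qed.

Lemma gP (m n : nat) : (1 < m)%N -> least_product_end m n (g m n)%:Z.
Proof.
move=> /(@product_sequence_from_to_exists _ n) ex_s.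
rewrite /g; case: xgetP => [s _ //|no_s].
have ex_b : exists s : nat, `[< product_sequence_from_to m n%:Z s%:Z >].
  by case: ex_s => s hs; exists s; apply/asboolP.
case: (ex_minnP ex_b) => s /asboolP hs min_s.
case: (no_s s); split=> // s' hs'.
have := product_sequence_from_to_le hs'.
case: s' hs' => // s' hs' _.
by rewrite lez_nat; apply: min_s; apply/asboolP.
Qed.

(* Main.v *)
(** For a prime [p], the exponents of a [p]-product sequence live in the field
    Z/p, so two such sequences with the same first term [n] and ends [s' < s]
    combine into one that starts beyond [n] and still ends at [s].  Hence, for a
    nonprime [s > 0], the largest [n] from which [s] is reachable satisfies
    [g p n = s]: every nonprime is a value of [g p].  Repeating every term
    [m / p] times gives [g m <= g p], and no value of [g m] is prime.  If
    [g m k < g p k], then choosing a [g p]-preimage of each nonprime below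
    [g p k] and adding [k] yields more points than there are nonprimes below
    [g p k], while [g m] sends all of them to such nonprimes. *)
Require Import Defs.
From mathcomp Require Import all_boot all_order all_algebra.
Import Order.TTheory GRing.Theory Num.Theory.

(** * Sequences as multiplicity functions *)

Lemma prod_count_mem (n s : nat) (b : seq nat) :
  all (fun x => n <= x <= s) b ->
  \prod_(x <- b) x = \prod_(n <= x < s.+1) x ^ count_mem x b.
Proof.
elim: b => [_|y b IHb /= /andP[/andP[ny ys] /IHb{}IHb]].
  by rewrite big_nil big1.
rewrite big_cons IHb; under [RHS]eq_bigr => x _ do rewrite expnD.
rewrite big_split /=; congr (_ * _).
rewrite (bigD1_seq y) ?iota_uniq ?mem_index_iota ?ny ?ltnS //=.
rewrite eqxx expn1 big1 ?muln1 // => x /negPf.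
by rewrite eq_sym => ->.
Qed.

Lemma expn_prod (I : Type) (r : seq I) (F : I -> nat) (k : nat) :
  (\prod_(i <- r) F i) ^ k = \prod_(i <- r) F i ^ k.
Proof. exact: (big_morph (expn^~ k) (fun x y => expnMn x y k) (exp1n k)). Qed.

Lemma count_mem_flatten_nseq (c : nat -> nat) (r : seq nat) (x : nat) :
  uniq r ->
  count_mem x (flatten [seq nseq (c y) y | y <- r]) = (x \in r) * c x.
Proof.
elim: r => [//|y r IHr /= /andP[yr /IHr{}IHr]].
rewrite count_cat count_nseq {}IHr in_cons /= [x == y]eq_sym.
by have [<-|//] := eqVneq y x; rewrite (negPf yr) addn0.
Qed.

Lemma sorted_head_last {T : eqType} (r : rel T) (x0 x : T) (a : seq T) :
  reflexive r -> transitive r -> sorted r a -> x \in a ->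
  r (head x0 a) x && r x (last x0 a).
Proof.
move=> r_refl r_trans r_a xa; rewrite -nth0 -nth_last -[X in r _ X && r X _](nth_index x0 xa).
have lt_xa : index x a < size a by rewrite index_mem.
have a_gt0 : 0 < size a by apply: leq_ltn_trans lt_xa.
by apply/andP; split; apply: sorted_leq_nth; rewrite ?inE ?prednK // -ltnS prednK.
Qed.

Lemma big_map_Posz (b : seq nat) :
  (\prod_(x <- map Posz b) x)%R = Posz (\prod_(x <- b) x).
Proof. by elim: b => [|x b IHb]; rewrite ?big_nil //= !big_cons IHb PoszM. Qed.

(** Encodes a sequence by the multiplicity [c x] of each value, so that exponents can be added and
    reduced modulo a prime. Values of [c] outside the interval from [n] to [s], apart from the bound
    by [m], are irrelevant. *)
Definition weighted_product (m n s : nat) : Prop :=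
  n <= s /\ exists c : nat -> nat,
    [/\ forall x, c x < m, 0 < c n, 0 < c s
      & exists R, \prod_(n <= x < s.+1) x ^ c x = R ^ m].

Lemma product_sequenceP (m n s : nat) : 0 < m ->
  product_sequence_from_to m (Posz n) (Posz s) <-> weighted_product m n s.
Proof.
move=> m0; split=> [h|[ns [c [cm cn cs [R eR]]]]].
  have := product_sequence_from_to_le h; rewrite lez_nat => ns; split=> //.
  case: h => a [[sa [R eR] cnt] a0 hd la].
  have mem_n : Posz n \in a by case: a a0 hd {sa eR cnt la} => //= ? ? _ ->; rewrite mem_head.
  have mem_s : Posz s \in a by case: a a0 la {sa eR cnt hd mem_n} => //= ? ? _ <-; rewrite mem_last.
  have bnd x : x \in a -> (Posz n <= x <= Posz s)%R.
    by move=> xa; rewrite -hd -la; apply: sorted_head_last xa => //; apply: le_trans.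
  (* All terms are at least [n], hence nonnegative, so [absz] loses nothing. *)
  pose b := map absz a.
  have eab : a = map Posz b.
    rewrite -map_comp -[LHS]map_id; apply/eq_in_map => x /bnd /andP[nx _] /=.
    by rewrite gez0_abs // (le_trans _ nx).
  have memb x : (x \in b) = (Posz x \in a).
    by rewrite eab mem_map // => ? ? [].
  exists (fun x => count_mem x b); split.
  - move=> x; have := cnt (Posz x); rewrite eab count_map.
    by rewrite -ltnS subn1 prednK //; apply: leq_ltn_trans; rewrite leq_eqVlt eq_refl.
  - by rewrite -has_count has_pred1 memb.
  - by rewrite -has_count has_pred1 memb.
  - exists R; rewrite -prod_count_mem; last first.
      by apply/allP => x; rewrite memb => /bnd; rewrite !lez_nat.
    move: eR; rewrite eab big_map_Posz -natz -[X in _ = (X ^+ _)%R]natz -natrX.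
    by rewrite !natz => -[].
pose b := sort leq (flatten [seq nseq (c y) y | y <- index_iota n s.+1]).
have cb x : count_mem x b = (n <= x <= s) * c x.
  by rewrite count_sort count_mem_flatten_nseq ?iota_uniq // mem_index_iota ltnS.
have memb x : (x \in b) = (n <= x <= s) && (0 < c x).
  by rewrite -has_pred1 has_count cb; case: (n <= x <= s); rewrite ?mul1n.
have sb : sorted leq b by apply: sort_sorted; apply: leq_total.
have nb : n \in b by rewrite memb leqnn ns.
have sb' : s \in b by rewrite memb leqnn ns.
have bnd x : x \in b -> n <= x <= s by rewrite memb => /andP[].
have hl x : x \in b -> head 0 b <= x <= last 0 b.
  by move=> xb; apply: sorted_head_last xb => //; apply: leq_trans.
have b0 : b <> [::] by move=> b0; rewrite b0 in nb.
have mem_hd : head 0 b \in b by case: b b0 {sb nb sb' bnd hl cb memb} => //= *; apply: mem_head.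
have mem_la : last 0 b \in b by case: b b0 {sb nb sb' bnd hl cb memb mem_hd} => //= *; apply: mem_last.
have hd : head 0 b = n.
  by apply/eqP; rewrite eqn_leq; case/andP: (hl _ nb) => -> _; case/andP: (bnd _ mem_hd).
have la : last 0 b = s.
  by apply/eqP; rewrite eqn_leq; case/andP: (hl _ sb') => _ ->; case/andP: (bnd _ mem_la) => _ ->.
exists (map Posz b); split.
- split.
  + by rewrite sorted_map; apply: sub_sorted sb => x y.
  + exists R; rewrite big_map_Posz (@prod_count_mem n s); last exact/allP.
    rewrite -natz -[X in _ = (X ^+ _)%R]natz -natrX -eR; congr (_%:R)%R.
    rewrite !big_seq; apply: eq_bigr => x; rewrite mem_index_iota ltnS => xns.
    by rewrite cb xns mul1n.
  + case=> x; last by rewrite count_map (eq_count (a2 := pred0)) ?count_pred0.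
    rewrite count_map (eq_count (a2 := pred1 x)) // cb.
    by rewrite -ltnS subn1 prednK //; case: (n <= x <= s); rewrite ?mul1n.
- by case: b b0 {sb nb sb' bnd hl cb memb mem_hd mem_la hd la}.
- by rewrite -hd; case: b b0 {sb nb sb' bnd hl cb memb mem_hd mem_la hd la}.
- by rewrite -la (last_map Posz b 0).
Qed.

(* Reduce the exponents modulo [p] and start at the first nonzero residue. *)
Lemma weighted_product_of_weights (p n s : nat) (d : nat -> nat) (R : nat) :
  0 < p -> 0 < n -> n <= s -> \prod_(n <= x < s.+1) x ^ d x = R ^ p ->
  ~~ (p %| d s) ->
  exists n', [/\ n <= n', ~~ (p %| d n') & weighted_product p n' s].
Proof.
move=> p0 n0 ns eR ds.
have exn : exists x, (n <= x) && ~~ (p %| d x) by exists s; rewrite ns.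
case: (ex_minnP exn) => n' /andP[nn' dn'] min.
have n's : n' <= s by apply: min; rewrite ns.
exists n'; split=> //; split=> //; exists (fun x => d x %% p).
split=> [x|||]; [by rewrite ltn_mod | by rewrite lt0n | by rewrite lt0n |].
(* Division with remainder splits [R ^ p] as [B ^ p * A]. Then [B] divides [R], and the quotient is
   a [p]-th root of [A]. By minimality of [n'], the factors of [A] below [n'] have exponent 0. *)
pose A := \prod_(n <= x < s.+1) x ^ (d x %% p).
have eA : \prod_(n' <= x < s.+1) x ^ (d x %% p) = A.
  rewrite /A (@big_cat_nat _ _ _ n' n) ?leqW //= [X in _ = X * _]big_nat_cond
    [X in X * _]big1 ?mul1n //.
  move=> x /andP[/andP[nx xn'] _].
  have [/eqP->//|dx] := boolP (p %| d x).
  by have := min x; rewrite nx dx leqNgt xn' => /(_ isT).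
pose B := \prod_(n <= x < s.+1) x ^ (d x %/ p).
have B0 : 0 < B.
  rewrite /B big_nat_cond prodn_cond_gt0 // => x /andP[/andP[nx _] _].
  by rewrite expn_gt0 (leq_trans n0 nx).
have eAB : B ^ p * A = R ^ p.
  rewrite -eR expn_prod -big_split /=; apply: eq_bigr => x _.
  by rewrite -expnM -expnD -divn_eq.
have /dvdnP[C eC] : B %| R by rewrite -(dvdn_pexp2r _ _ p0) -eAB dvdn_mulr.
exists C; apply/eqP; rewrite eA -(eqn_pmul2l (m := B ^ p)) ?expn_gt0 ?B0 //.
by rewrite eAB eC mulnC expnMn.
Qed.

(** * Bounds on [g] and its values *)

Lemma g_weighted_product (m n : nat) : 1 < m -> weighted_product m n (g m n).
Proof.
by move=> m1; apply/product_sequenceP; [apply: ltnW | case: (gP n m1)].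
Qed.

Lemma g_min (m n s : nat) : 1 < m -> weighted_product m n s -> g m n <= s.
Proof.
move=> m1 /(product_sequenceP _ _ _ (ltnW m1)) h.
by case: (gP n m1) => _ /(_ _ h); rewrite lez_nat.
Qed.

Lemma g_ge (m n : nat) : 1 < m -> n <= g m n.
Proof. by case/(g_weighted_product m n). Qed.

Lemma g0 (m : nat) : 1 < m -> g m 0 = 0.
Proof.
move=> m1; apply/eqP; rewrite -leqn0; apply: g_min => //; split=> //.
exists (fun _ => 1); split=> //; exists 0.
by rewrite big_nat1 expn1 exp0n // ltnW.
Qed.

(** A prime [q] divides none of the positive integers below it, so its valuation in the product is
    [c q]. This would be a multiple of [m] strictly between 0 and [m]. *)
Lemma weighted_product_not_prime (m n q : nat) :
  0 < n -> weighted_product m n q -> ~~ prime q.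
Proof.
move=> n0 [nq [c [cm _ cq [R eR]]]]; apply/negP => pq.
move/(congr1 (logn q)): eR; rewrite big_nat_recr //= lognX logn_Gauss; last first.
  rewrite big_nat_cond; apply: (big_ind (coprime q)) => [|x y|x].
  - exact: coprimen1.
  - by rewrite coprimeMr => -> ->.
  - move=> /andP[/andP[nx xq] _]; apply: coprimeXr.
    by rewrite prime_coprime // gtnNdvd // (leq_trans n0 nx).
rewrite pfactorK // => e; have := cm q; rewrite ltnNge dvdn_leq //.
by rewrite e dvdn_mulr.
Qed.

Lemma g_not_prime (m n : nat) : 1 < m -> ~~ prime (g m n).
Proof.
move=> m1; case: n => [|n]; first by rewrite g0.
exact: weighted_product_not_prime (g_weighted_product m n.+1 m1).
Qed.

Lemma g_le_dvdn (m p n : nat) : 1 < p -> 0 < m -> p %| m -> g m n <= g p n.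
Proof.
move=> p1 m0 pm; have m1 : 1 < m by apply: leq_trans p1 (dvdn_leq m0 pm).
case/dvdnP: pm m0 m1 => r -> rp0 m1.
have r0 : 0 < r by move: rp0; rewrite muln_gt0 => /andP[].
apply: g_min => //; have [ns [c [cp cn cs [R eR]]]] := g_weighted_product p n p1.
split=> //; exists (fun x => c x * r); split=> [x|||].
- by rewrite [r * p]mulnC ltn_pmul2r.
- by rewrite muln_gt0 cn.
- by rewrite muln_gt0 cs.
- exists R; rewrite mulnC expnM -eR expn_prod.
  by apply: eq_bigr => x _; rewrite expnM.
Qed.

(** * Nonprimes as values of [g p] *)

Lemma nonprime_weighted_product (p s : nat) : 1 < p -> 0 < s -> ~~ prime s ->
  exists2 n, 0 < n & weighted_product p n s.
Proof.
(* The weights take [s] once and its prime factorization [p.-1] times, with product [s * s ^ p.-1].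
   As [s] is not prime, the factorization does not touch the weight 1 at [s]. *)
move=> p1 s0 ps; pose d (x : nat) := (x == s) + p.-1 * logn x s.
have ds : d s = 1 by rewrite /d eqxx lognE (negPf ps) muln0.
have es : \prod_(1 <= x < s.+1) x ^ logn x s = s.
  rewrite -[RHS](partnT s0) (@widen_partn s) // [RHS]big_mkcond [RHS]big_ltn //= mul1n.
  by apply: eq_bigr => x _.
have [|||n [n0 _ h]] := @weighted_product_of_weights p 1 s d s (ltnW p1) _ s0.
- by [].
- under eq_bigr => x _ do rewrite expnD mulnC [p.-1 * _]mulnC expnM.
  rewrite big_split /= -expn_prod.
  rewrite es (bigD1_seq s) ?iota_uniq ?mem_index_iota ?s0 ?ltnS //=.
  rewrite eqxx expn1 big1 => [|x /negPf-> //].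
  by rewrite muln1 -expnSr prednK // ltnW.
- by rewrite ds dvdn1 gtn_eqF.
by exists n.
Qed.

(* The combined exponents cancel modulo [p] at [n] and are nonzero at [s]. *)
Lemma weighted_product_advance (p n s s' : nat) : prime p -> 0 < n -> s' < s ->
  weighted_product p n s -> weighted_product p n s' ->
  exists2 n', n < n' & weighted_product p n' s.
Proof.
move=> pp n0 ss [ns [c [cp cn cs [R eR]]]] [ns' [d [dp dn ds [R' eR']]]].
have p0 := prime_gt0 pp.
have small k : 0 < k -> k < p -> ~~ (p %| k).
  by move=> k0 kp; apply/negP => /(dvdn_leq k0); rewrite leqNgt kp.
(* At [n] the weight is [p * c n * d n]. At [s] only the first sequence contributes, giving
   [c s * d n], a product of nonzero residues modulo the prime [p]. The test cuts off [d], which is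
   unconstrained by the product beyond [s']. *)
pose e x := c x * d n + (if x <= s' then d x * (p.-1 * c n) else 0).
have e_n : p %| e n.
  rewrite /e ns' [d n * _]mulnC -mulnDl -mulSn prednK //.
  by rewrite -mulnA dvdn_mulr.
have [||n' [nn' dn' h]] := @weighted_product_of_weights p n s e (R ^ d n * R' ^ (p.-1 * c n)) p0 n0 ns.
- under eq_bigr => x _ do rewrite expnD expnM.
  rewrite big_split /= expnMn ![(_ ^ _) ^ p]expnAC -eR -eR' !expn_prod.
  congr (_ * _).
  rewrite (@big_cat_nat _ _ _ s'.+1 n) ?leqW //= [X in _ * X]big_nat_cond.
  rewrite [X in _ * X]big1 ?muln1 => [|x /andP[/andP[]]]; last by rewrite ltnNge => /negPf->.
  by rewrite !big_nat; apply: eq_bigr => x /andP[_]; rewrite ltnS => ->; rewrite -expnM.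
- by rewrite /e leqNgt ss addn0 Euclid_dvdM // negb_or !small.
exists n' => //; rewrite ltn_neqAle nn' andbT.
by apply: contraNneq dn' => <-.
Qed.

Lemma g_prime_surj (p s : nat) : prime p -> ~~ prime s -> exists n, g p n = s.
Proof.
move=> pp; have p1 := prime_gt1 pp.
case: (posnP s) => [-> _|s0 ps]; first by exists 0; apply: g0.
have [n n0] := nonprime_weighted_product p s p1 s0 ps.
(* Advancing the start shrinks [s - n], since a start never exceeds its end; so the process stops
   with [g p n = s]. *)
have [k] := ubnP (s - n); elim: k n n0 => // k IHk n n0 lt_k h.
have := g_min p n s p1 h; rewrite leq_eqVlt => /orP[/eqP|lt_gs]; first by exists n.
have [n' nn' h'] := weighted_product_advance p n s _ pp n0 lt_gs h (g_weighted_product p n p1).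
apply: (IHk n') => //; first exact: leq_ltn_trans nn'.
by case: h' => n's _; apply: leq_trans (ltn_sub2l (leq_trans nn' n's) nn') lt_k.
Qed.

Theorem theorem5p7 (m p : nat) (hm : 2 <= m) (hp : prime p) (hpm : p %| m)
  (hk : exists k : nat, g m k <> g p k) : ~ injective (g m).
Proof.
case: hk => k neq_k inj_g; have p1 := prime_gt1 hp.
have le_g n : g m n <= g p n by apply: g_le_dvdn => //; apply: ltnW.
have lt_k : g m k < g p k by rewrite ltn_neqAle le_g andbT; apply/eqP.
pose N := g p k.
pose Q := [seq s <- iota 0 N | ~~ prime s].
pose L := [seq n <- iota 0 N | g p n < N].
(* A preimage [n] of a nonprime [s < N] satisfies [n <= g p n = s], so it lies in the range that [L]
   filters. *)
have le_QL : size Q <= size L.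
  rewrite -[size L](size_map (g p)); apply: uniq_leq_size.
    by rewrite filter_uniq ?iota_uniq.
  move=> s; rewrite mem_filter mem_iota add0n => /andP[ps /= sN].
  have [n gn] := g_prime_surj p s hp ps.
  rewrite -gn map_f // mem_filter mem_iota add0n gn sN /=.
  by apply: leq_ltn_trans sN; rewrite -gn g_ge.
have kL : k \notin L by rewrite mem_filter ltnn.
(* The pigeonhole contradiction: [g m] would inject [k :: L] into [Q], as its values are nonprime
   and lie below [N], at [k] by [lt_k] and on [L] by [le_g]. *)
suff : size (k :: L) <= size Q by rewrite leqNgt ltnS le_QL.
rewrite -(size_map (g m)); apply: uniq_leq_size.
  by rewrite map_inj_uniq //= kL filter_uniq ?iota_uniq.
move=> s /mapP[n]; rewrite in_cons => n_in ->.
rewrite mem_filter g_not_prime //= mem_iota add0n /=.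
case/predU1P: n_in => [->//|]; rewrite mem_filter => /andP[gn _].
exact: leq_ltn_trans (le_g n) gn.
Qed.
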